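(* Let $\beta\in(0,1]$ and let $H^2(\beta)$ be the weighted Hardy space with weights $\beta_n^2=(1/\beta)^n$. Let $C_\phi\in B(H^2(\beta))$ be the composition operator with symbol $\phi(w)=\eta w$, $w\in\mathbb{D}$, where $\eta\in\mathbb{T}$. Then the Berezin range $\mathrm{Ber}(C_\phi)$ is convex if and only if $\eta=1$ or $\eta=-1$.
   Context: $\mathbb D$ is the open unit disc in $\mathbb{C}$ and $\mathbb T$ the unit circle. For $\beta\in(0,1]$ and $\beta_n^2=(1/\beta)^n$, $H^2(\beta)$ is the Hilbert space of $f(z)=\sum_{n\ge0}a_nz^n$ with $\sum_n|a_n|^2\beta_n^2<\infty$ and inner product $\langle f,g\rangle=\sum_n a_n\overline{b_n}\beta_n^2$ (where $g(z)=\sum_n b_nz^n$), viewed as a reproducing kernel Hilbert space of analytic functions on $\mathbb D$ with reproducing kernel $k_w(z)=\frac{1}{1-\beta\overline{w}z}$, $w,z\in\mathbb D$. $B(H^2(\beta))$ is the set of bounded linear operators on it, and $C_\phi f=f\circ\phi$. With $\hat k_w=k_w/\|k_w\|$, the Berezin transform of a bounded operator $A$ is $\widetilde A(w)=\langle A\hat k_w,\hat k_w\rangle$ and its Berezin range is $\mathrm{Ber}(A)=\{\widetilde A(w):w\in\mathbb D\}\subset\mathbb C$. *)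

(* Defs.v *)
From HB Require Import structures.
From mathcomp Require Import all_boot all_order all_algebra.
From mathcomp Require Import complex lra.
From mathcomp Require Import all_classical all_reals all_analysis.

Set Implicit Arguments.
Unset Strict Implicit.
Unset Printing Implicit Defensive.
Import Order.TTheory GRing.Theory Num.Theory numFieldNormedType.Exports.
Import Normc.

Local Open Scope classical_set_scope.
Local Open Scope ring_scope.
Local Open Scope complex_scope.

Definition unit_disc (R : realType) : Type := {z : R[i] | `|z| < 1}.

(* An element of H^2(w) is represented by its sequence of Taylor coefficients;
   R[i]^o is R[i] with its scalar multiplication and topology as a C-vector
   space. *)
Definition hardy_pred (R : realType) (w : nat -> R) : {pred nat -> R[i]^o} :=
  fun a => `[< cvgn (series (fun n => normc (a n) ^+ 2 * w n ^+ 2)) >].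

Section hardy_submod.
Variables (R : realType) (w : nat -> R).

Lemma hardy_submod_closed : submod_closed (hardy_pred w).
Proof.
split.
  apply/asboolP; rewrite (_ : (fun n => _) = fun=> 0).
    rewrite /series /=; under eq_fun do rewrite big1//.
    exact: is_cvg_cst.
  by apply/funext => n; rewrite normc0 expr0n/= mul0r.
move=> c u v /asboolP hu /asboolP hv; apply/asboolP.
set U := (fun n => _) in hu; set V := (fun n => _) in hv.
have U0 n : 0 <= U n by rewrite /U -exprMn sqr_ge0.
have V0 n : 0 <= V n by rewrite /V -exprMn sqr_ge0.
apply: (@series_le_cvg _ _ ((2 * normc c ^+ 2) *: U + 2 *: V)).
- by move=> n; rewrite -exprMn sqr_ge0.
- move=> n; rewrite !fctE /GRing.scale/=.
  apply: addr_ge0; apply: mulr_ge0; rewrite ?U0 ?V0//.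
  by apply: mulr_ge0 => //; exact: sqr_ge0.
- move=> n; rewrite !fctE /GRing.scale/= /U /V.
  set W := w n ^+ 2; have W0 : 0 <= W by exact: sqr_ge0.
  have h : normc (c * u n + v n) <= normc c * normc (u n) + normc (v n).
    by rewrite -normcM; exact: le_normcD.
  have n0 (x : R[i]) : 0 <= normc x by case: x => ? ?; exact: sqrtr_ge0.
  apply: (@le_trans _ _ ((normc c * normc (u n) + normc (v n)) ^+ 2 * W)).
    apply: ler_wpM2r => //.
    by rewrite ler_pXn2r ?nnegrE ?n0//; apply: addr_ge0 => //; apply: mulr_ge0.
  move: (normc c) (normc (u n)) (normc (v n)) => x y z.
  have := mulr_ge0 (sqr_ge0 (x * y - z)) W0.
  lra.
- apply: is_cvg_seriesD; apply: is_cvg_seriesZ; [exact: hu|exact: hv].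
Qed.

HB.instance Definition _ := GRing.isSubmodClosed.Build R[i] (nat -> R[i]^o)
  (hardy_pred w) hardy_submod_closed.

Record hardy := Hardy {
  coef :> nat -> R[i]^o ;
  coefP : coef \in hardy_pred w }.

HB.instance Definition _ := [isSub for coef].
HB.instance Definition _ := [Choice of hardy by <:].
HB.instance Definition _ := [SubChoice_isSubLmodule of hardy by <:].

End hardy_submod.

Section hardy_theory.
Variables (R : realType) (w : nat -> R).
Local Notation H := (hardy w).
Implicit Types (f g : H) (T : {linear H -> H}) (phi : unit_disc R -> unit_disc R).

Definition hardy_eval f (z : unit_disc R) : R[i]^o :=
  limn (series (fun n => f n * val z ^+ n)).

Definition hardy_dot f g : R[i]^o :=
  limn (series (fun n => f n * (g n)^* * (w n ^+ 2)%:C)).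

Definition hardy_norm f : R := Num.sqrt (complex.Re (hardy_dot f f)).

Definition bounded_operator T : Prop :=
  exists M : R, forall f, hardy_norm (T f) <= M * hardy_norm f.

Definition composition_operator phi T : Prop :=
  forall f z, hardy_eval (T f) z = hardy_eval f (phi z).

End hardy_theory.

Definition geom_weight (R : realType) (beta : R) (n : nat) : R :=
  Num.sqrt ((1 / beta) ^+ n).

Lemma sqr_geom_weight (R : realType) (beta : R) n :
  0 < beta -> geom_weight beta n ^+ 2 = (1 / beta) ^+ n.
Proof. by move=> b0; rewrite sqr_sqrtr// exprn_ge0// divr_ge0// ltW. Qed.

Notation H2 beta := (hardy (geom_weight beta)).

Lemma cvg_geometric_seriesC (R : realType) (z : R[i]) : `|z| < 1 ->
  series (fun n => z ^+ n : R[i]^o) @ \oo --> ((1 - z)^-1 : R[i]^o).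
Proof.
move=> z1.
have z1N : 1 - z != 0.
  by rewrite subr_eq0; apply: contraTneq z1 => <-; rewrite normr1 ltxx.
have rz : normc z < 1 by rewrite -ltcR; case: z z1 {z1N}.
have rz0 : 0 <= normc z by case: z {z1 z1N rz} => ? ?; exact: sqrtr_ge0.
have cz : (fun n => z ^+ n : R[i]^o) @ \oo --> (0 : R[i]^o).
  apply/cvgrPdist_lt => /= e e0.
  have eRe : e = (complex.Re e)%:C by case: e e0 => a b; rewrite ltcE/= => /andP[/eqP -> _].
  have e0' : 0 < complex.Re e by rewrite -ltcR -eRe.
  have : (fun n => normc z ^+ n) @ \oo --> (0 : R).
    by apply: cvg_expr; rewrite ger0_norm.
  move=> /cvgrPdist_lt /(_ _ e0'); apply: filterS => n /=.
  rewrite !sub0r !normrN ger0_norm ?exprn_ge0// eRe => h.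
  have nzn : `|z ^+ n : R[i]^o| = (normc z ^+ n)%:C.
    by rewrite rmorphXn/= -[LHS]/(`|z ^+ n : R[i]|) normrX; case: (z).
  by rewrite nzn ltcR.
rewrite (_ : series _ = fun n => (1 - z ^+ n) * (1 - z)^-1); last first.
  apply/funext => n; rewrite /series/= big_mkord.
  by apply: (mulfI z1N); rewrite mulrCA divff// mulr1 -opprB mulNr -subrX1 opprB.
rewrite -[X in _ --> X]mul1r; apply: cvgMl.
have c1 : (fun _ : nat => 1 : R[i]^o) @ \oo --> (1 : R[i]^o) by exact: cvg_cst.
have h := cvgB c1 cz.
rewrite subr0 in h.
exact: h.
Qed.

Section kernel.
Variables (R : realType) (beta : R) (hbeta : 0 < beta <= 1).
Implicit Types w z : unit_disc R.

(* The Taylor coefficients of z |-> (1 - beta w^* z)^-1, see [kernelE]. *)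
Definition kernel_coef w (n : nat) : R[i]^o := (beta%:C * (val w)^*) ^+ n.

Lemma kernel_coefP w : kernel_coef w \in hardy_pred (geom_weight beta).
Proof.
have /andP[b0 b1] := hbeta.
apply/asboolP; set x := val w.
have x1 : normc x < 1 by have := valP w; rewrite -/x -ltcR; case: x.
have x0 : 0 <= normc x by case: x {x1} => ? ?; exact: sqrtr_ge0.
have bE : normc beta%:C = beta by rewrite /= expr0n/= addr0 sqrtr_sqr gtr0_norm.
have xE : normc x^* = normc x by case: x {x1 x0} => a b /=; rewrite sqrrN.
have nX (y : R[i]) n : normc (y ^+ n) = normc y ^+ n.
  by elim: n => [|n ih]; rewrite ?expr0 ?normc1// !exprS normcM ih.
rewrite (_ : (fun n => _) = geometric 1 (beta * normc x ^+ 2)).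
  apply: is_cvg_geometric_series.
  have x2 : 0 <= normc x ^+ 2 by exact: sqr_ge0.
  rewrite ger0_norm; last by apply: mulr_ge0 => //; exact: ltW.
  by rewrite (le_lt_trans (ler_piMl x2 b1))// expr_lt1.
apply/funext => n /=; rewrite sqr_geom_weight// /kernel_coef nX normcM bE xE.
rewrite !mul1r -exprM mulnC exprM -exprMn; congr (_ ^+ _).
by rewrite exprMn mulrAC expr2 mulfK ?gt_eqF.
Qed.

Definition kernel w : H2 beta := Hardy (kernel_coefP w).

Lemma kernelE w z :
  hardy_eval (kernel w) z = (1 - beta%:C * (val w)^* * val z)^-1.
Proof.
have /andP[b0 b1] := hbeta.
have hx : `|beta%:C * (val w)^* * val z| < 1.
  have wE : `|(val w)^*| = `|val w|.
    by case: (val w) => a b /=; simpc; rewrite sqrrN.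
  have bE : `|beta%:C| <= 1 by rewrite ger0_norm lecR// ltW.
  rewrite !normrM wE (le_lt_trans _ (valP z))// ler_piMl// mulr_ile1//.
  by rewrite ltW// (valP w).
apply: (cvg_lim (@norm_hausdorff _ _)).
under eq_fun do rewrite /= -exprMn.
exact: (cvg_geometric_seriesC hx).
Qed.

Lemma kernel_reproducing (f : H2 beta) w :
  hardy_dot f (kernel w) = hardy_eval f w.
Proof.
have /andP[b0 _] := hbeta.
rewrite /hardy_dot /hardy_eval; congr (limn (series _)); apply/funext => n.
rewrite sqr_geom_weight//= /kernel_coef -mulrA; congr (_ * _).
rewrite [X in X * _](_ : _ = (beta%:C * val w) ^+ n); last first.
  rewrite -[LHS]/(conjc _) rmorphXn; congr (_ ^+ _).
  by rewrite rmorphM; congr (_ * _); [exact: conjc_real|exact: conjcK].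
rewrite rmorphXn -exprMn; congr (_ ^+ _).
by rewrite mulrAC -rmorphM/= mulrC div1r mulfV ?gt_eqF// rmorph1 mulr1.
Qed.

Definition normalized_kernel w : H2 beta :=
  ((hardy_norm (kernel w))^-1)%:C *: kernel w.

Definition berezin_transform (T : {linear H2 beta -> H2 beta}) w : R[i] :=
  hardy_dot (T (normalized_kernel w)) (normalized_kernel w).

Definition berezin_range (T : {linear H2 beta -> H2 beta}) : set R[i] :=
  range (berezin_transform T).

End kernel.

(* Convexity in C as a real vector space: [Rcomplex R] is R[i] with its R-module
   structure. *)
Definition convexC (R : realType) (A : set R[i]) : Prop :=
  convex_set (A : set (convex_lmodType (Rcomplex R))).

(* Main.v *)
Require Import Defs.
From HB Require Import structures.
From mathcomp Require Import all_boot all_order all_algebra.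
From mathcomp Require Import complex.
From mathcomp Require Import all_classical all_reals all_analysis.
From mathcomp Require Import ring lra.
Set Implicit Arguments.
Unset Strict Implicit.
Unset Printing Implicit Defensive.
Import Order.TTheory GRing.Theory Num.Theory numFieldNormedType.Exports.
Local Open Scope classical_set_scope.
Local Open Scope ring_scope.
Local Open Scope complex_scope.

(** Write [k_w] for the kernel at [w].  Since [C_phi k_w = k_w o phi], the
    reproducing property gives the Berezin transform of a composition operator
    in closed form (lemma [berezin_transform_composition]):
      [(1 - beta |w|^2) / (1 - beta w^* phi(w))].
    For [phi w = eta w] it depends on [w] only through [s := beta |w|^2], so the
    Berezin range is the curve [g s := (1 - s) / (1 - eta s)], [0 <= s < beta]
    (lemma [berezin_range_rotation]).

    For [eta = 1] the curve is the point [1]; for [eta = -1] it is a real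
    interval (lemma [convex_curveN1]).  Otherwise, [eta] being unimodular, its
    imaginary part is nonzero.  As
      [1 - g s = (1 - eta) * s / (1 - eta s)],
    the midpoint of [g 0 = 1] and [g s] is some [g u] only if
      [u (1 - eta s) = s (1 - eta u) / 2],
    that is [u - s / 2 = eta u s / 2].  Imaginary parts yield [u s = 0] and then
    real parts yield [s = 0]; hence no midpoint of [1] and [g s] with [s > 0]
    lies on the curve (lemma [convex_curve_Im]). *)

(** * Complex scalars and convexity in the complex plane *)

Lemma real_complexB1 (R : realType) (s : R) : (1 - s)%:C = 1 - s%:C.
Proof. by rewrite rmorphB rmorph1. Qed.

Lemma mulC_conj (R : realType) (z : R[i]) : z^* * z = (Normc.normc z ^+ 2)%:C.
Proof.
case: z => a b; rewrite /= sqr_sqrtr ?addr_ge0 ?sqr_ge0//.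
by simpc; congr (_ +i* _); ring.
Qed.

Lemma convexCP (R : realType) (A : set R[i]) :
  convexC A <-> forall (x y : R[i]) (t : R), 0 <= t <= 1 -> A x -> A y ->
    A (t%:C * x + (1 - t)%:C * y).
Proof.
have scE (t : R) (x : Rcomplex R) : t *: x = t%:C * (x : R[i]).
  by case: x => a b; simpc.
split=> [cA x y t t01 Ax Ay|cA x y l /set_mem Ax /set_mem Ay].
  have /andP[t0 t1] := t01.
  have := cA x y (Itv01 t0 t1) (mem_set Ax) (mem_set Ay).
  by move=> /set_mem; rewrite /conv/= !scE.
apply/mem_set; rewrite /conv/= !scE; apply: cA => //.
by rewrite ge0 le1.
Qed.

(** * The Berezin transform of a composition operator *)

Section berezin.
Variables (R : realType) (beta : R) (hbeta : 0 < beta <= 1).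
Implicit Types (w z : unit_disc R) (T : {linear H2 beta -> H2 beta}).

Definition sqr_modulus w : R := Normc.normc (val w) ^+ 2.

Lemma sqr_modulus_ge0 w : 0 <= sqr_modulus w.
Proof. exact: sqr_ge0. Qed.

Lemma sqr_modulus_lt1 w : sqr_modulus w < 1.
Proof.
rewrite /sqr_modulus; have := valP w; case: (val w) => a b /=.
by rewrite ltcR => ?; rewrite expr_lt1// sqrtr_ge0.
Qed.

Lemma hardy_normK_kernel w :
  hardy_norm (Defs.kernel hbeta w) ^+ 2 = (1 - beta * sqr_modulus w)^-1.
Proof.
have /andP[b0 b1] := hbeta.
have /= s0 := sqr_modulus_ge0 w; have /= s1 := sqr_modulus_lt1 w.
rewrite /hardy_norm kernel_reproducing kernelE -mulrA mulC_conj -rmorphM.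
rewrite -real_complexB1 -fmorphV/= sqr_sqrtr//.
rewrite invr_ge0 -/(sqr_modulus w); nra.
Qed.

(** The scalar comes out of the limit because the Taylor series of the kernel is
    a convergent geometric series. *)
Lemma hardy_evalZ_kernel (c : R[i]) w z :
  hardy_eval (c *: Defs.kernel hbeta w) z = c * hardy_eval (Defs.kernel hbeta w) z.
Proof.
have /andP[b0 b1] := hbeta.
rewrite kernelE; set x := _ * val z.
have x1 : `|x| < 1.
  have wE : `|(val w)^*| = `|val w|.
    by case: (val w) => a b /=; simpc; rewrite sqrrN.
  have bE : `|beta%:C| <= 1 by rewrite ger0_norm lecR// ltW.
  rewrite !normrM wE (le_lt_trans _ (valP z))// ler_piMl// mulr_ile1//.
  by rewrite ltW// (valP w).
apply: (cvg_lim (@norm_hausdorff _ _)).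
rewrite (_ : series _ = fun n => c * series (fun k => x ^+ k : R[i]^o) n).
  exact: cvgMl_tmp (cvg_geometric_seriesC x1).
apply/funext => n; rewrite /series/= mulr_sumr; apply: eq_bigr => k _.
by rewrite exprMn mulrA.
Qed.

(** The real scalar of the normalized kernel moves from the second argument of
    the inner product to the first term by term, as an identity of series and
    not of their limits; the reproducing property then leaves an evaluation. *)
Lemma berezin_transformE T w :
  berezin_transform hbeta T w =
  hardy_eval (T ((hardy_norm (Defs.kernel hbeta w) ^- 2)%:C *: Defs.kernel hbeta w)) w.
Proof.
rewrite -kernel_reproducing /berezin_transform /normalized_kernel.
set c := (hardy_norm _)^-1; rewrite -exprVn -/c.
rewrite expr2 rmorphM -scalerA [in RHS]linearZ /hardy_dot.
congr (limn (@series (R[i]^o) _)); apply/funext => n /=.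
congr (_ * _); set f := T _.
change (f n * (c%:C * kernel_coef beta w n)^* =
  c%:C * f n * (kernel_coef beta w n)^*).
rewrite -[X in _ * X = _]/(conjc _) rmorphM/= oppr0.
by rewrite mulrA [f n * _]mulrC.
Qed.

Lemma berezin_transform_composition phi T w :
  composition_operator phi T ->
  berezin_transform hbeta T w =
  (1 - beta * sqr_modulus w)%:C / (1 - beta%:C * (val w)^* * val (phi w)).
Proof.
move=> Tphi; rewrite berezin_transformE Tphi hardy_evalZ_kernel kernelE.
by rewrite hardy_normK_kernel invrK.
Qed.

End berezin.

(** * The curve of a rotation *)

Section curve.
Variable R : realType.
Implicit Types (eta : R[i]) (beta : R).

Definition rotation_curve eta beta : set R[i] :=
  [set (1 - s)%:C / (1 - eta * s%:C) | s in [set s : R | 0 <= s < beta]].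

Lemma rotation_curve_1 eta beta : 0 < beta -> rotation_curve eta beta 1.
Proof.
move=> b0; exists 0; first by rewrite /= lexx.
by rewrite real_complexB1 rmorph0 mulr0 !subr0 divr1.
Qed.

Lemma berezin_range_rotation beta (hbeta : 0 < beta <= 1) eta
    (phi : unit_disc R -> unit_disc R) (T : {linear H2 beta -> H2 beta}) :
  (forall z, val (phi z) = eta * val z) -> composition_operator phi T ->
  berezin_range hbeta T = rotation_curve eta beta.
Proof.
move=> phiE Tphi; have /andP[b0 b1] := hbeta.
have gE w : berezin_transform hbeta T w =
    (1 - beta * sqr_modulus w)%:C / (1 - eta * (beta * sqr_modulus w)%:C).
  rewrite (berezin_transform_composition hbeta _ Tphi) phiE; congr (_ / (1 - _)).
  rewrite mulrCA; congr (_ * _).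
  by rewrite -mulrA mulC_conj -rmorphM.
apply/seteqP; split=> [_ [w _ <-]|_ [s /= /andP[s0 sb] <-]].
  exists (beta * sqr_modulus w); last by rewrite gE.
  have := sqr_modulus_ge0 w; have := sqr_modulus_lt1 w.
  by move=> /= ? ?; apply/andP; split; nra.
have q0 : 0 <= s / beta by rewrite divr_ge0// ltW.
have q1 : s / beta < 1 by rewrite ltr_pdivrMr ?mul1r.
have z1 : `|(Num.sqrt (s / beta))%:C| < 1.
  rewrite ger0_norm ?ler0c ?sqrtr_ge0// ltcR.
  by rewrite -sqrtr1 ltr_sqrt.
(* A point of the disc with [beta |w|^2 = s]. *)
exists (exist (fun z : R[i] => `|z| < 1) _ z1) => //; rewrite gE.
rewrite [_ * sqr_modulus _](_ : _ = s)// /sqr_modulus /=.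
rewrite expr0n addr0 sqrtr_sqr ger0_norm ?sqrtr_ge0// sqr_sqrtr//.
by rewrite mulrCA divff ?mulr1// gt_eqF.
Qed.

Lemma convex_curve1 beta : 0 < beta <= 1 -> convexC (rotation_curve 1 beta).
Proof.
move=> /andP[b0 b1]; apply/convexCP.
have curveE x : rotation_curve 1 beta x <-> x = 1.
  split=> [[s /= /andP[s0 sb] <-]|->].
    rewrite mul1r -real_complexB1 divff//=.
    by rewrite eq_complex/= eqxx andbT gt_eqF// subr_gt0 (lt_le_trans sb).
  exact: rotation_curve_1.
move=> x y t _ /curveE -> /curveE ->; apply/curveE.
by rewrite !mulr1 -rmorphD/= addrC subrK.
Qed.

(** [s |-> (1 - s) / (1 + s)] is a decreasing involution, so the curve is the
    interval from [(1 - beta) / (1 + beta)] (excluded) to [1]. *)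
Lemma rotation_curveN1 beta : 0 < beta <= 1 ->
  rotation_curve (-1) beta =
  [set r%:C | r in [set r : R | 1 - beta < r * (1 + beta) /\ r <= 1]].
Proof.
move=> /andP[b0 b1].
have gE (s : R) :
    (1 - s)%:C / (1 - -1 * s%:C) = ((1 - s) / (1 + s))%:C.
  by rewrite mulN1r -rmorphN -real_complexB1 opprK fmorph_div.
apply/seteqP; split=> [_ [s /= /andP[s0 sb] <-]|_ [r /= [rb r1] <-]].
  have s1 : 0 < 1 + s by lra.
  exists ((1 - s) / (1 + s)); last by rewrite gE.
  split; last by rewrite ler_pdivrMr//; lra.
  by rewrite mulrAC ltr_pdivlMr//; nra.
have r0 : 0 < 1 + r by nra.
exists ((1 - r) / (1 + r)).
  rewrite /= divr_ge0 ?subr_ge0//=; last by lra.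
  by rewrite ltr_pdivrMr//; lra.
by rewrite gE; congr (_%:C); field; rewrite gt_eqF//=; lra.
Qed.

Lemma convex_curveN1 beta : 0 < beta <= 1 -> convexC (rotation_curve (-1) beta).
Proof.
move=> hbeta; rewrite rotation_curveN1//; apply/convexCP.
move=> _ _ t /andP[t0 t1] [x [/= xb x1] <-] [y [/= yb y1] <-].
exists (t * x + (1 - t) * y); last by rewrite rmorphD !rmorphM.
split=> /=; last by nra.
have := hbeta => /andP[b0 b1].
have [->|tn0] := eqVneq t 0; first by lra.
have tp : 0 < t by rewrite lt_neqAle eq_sym tn0.
nra.
Qed.

(** When the imaginary part is nonzero, the midpoint of [1] (the value at the
    origin of the disc) and any other point of the curve is off the curve. *)
Lemma convex_curve_Im eta beta : 0 < beta <= 1 -> `|eta| = 1 ->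
  convexC (rotation_curve eta beta) -> complex.Im eta = 0.
Proof.
move=> /andP[b0 b1] eta1 /convexCP cvx.
have den0 (s : R) : 0 <= s < beta -> 1 - eta * s%:C != 0.
  move=> /andP[s0 sb]; rewrite subr_eq0; apply/eqP => /(congr1 Num.norm).
  rewrite normrM eta1 mul1r normr1 ger0_norm ?ler0c// => /eqP.
  by rewrite eq_complex/= => /andP[/eqP]; lra.
have [s s0 sb] : exists2 s, 0 < s & 0 <= s < beta by exists (beta / 2); lra.
have g0 := rotation_curve_1 eta b0.
have gs : rotation_curve eta beta ((1 - s)%:C / (1 - eta * s%:C)) by exists s.
have h01 : 0 <= (2^-1 : R) <= 1 by lra.
have [u /= ub uE] := cvx _ _ _ h01 gs g0.
have [->|eta_neq1] := eqVneq eta 1; first by [].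
(* The parameter [u] of the midpoint solves the equation obtained from
   [1 - g u = (1 - g s) / 2] by cancelling the factor [1 - eta]. *)
have key : u%:C * (1 - eta * s%:C) = (2^-1)%:C * s%:C * (1 - eta * u%:C).
  have := den0 _ ub; have := den0 _ sb; move: uE; rewrite !real_complexB1.
  move: (s%:C) (u%:C) ((2^-1)%:C) => S U h uE S0 U0.
  have gE (x : R[i]) : 1 - eta * x != 0 ->
      1 - (1 - x) / (1 - eta * x) = (1 - eta) * (x / (1 - eta * x)).
    by move=> x0; field.
  have : (1 - eta) * (U / (1 - eta * U)) =
         (1 - eta) * (h * (S / (1 - eta * S))).
    by rewrite [RHS]mulrCA -!gE // uE; ring.
  have eta1N : 1 - eta != 0 by rewrite subr_eq0 eq_sym.
  move=> /(mulfI eta1N) e.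
  by rewrite -[in LHS](divfK U0 U) e; field.
move: key; case: (eta) => a b; simpc => -[kR kI] /=.
apply/eqP; apply/negPn/negP => bn0.
have : b * (u * s) = 0 by lra.
move=> /eqP; rewrite !mulf_eq0 (negPf bn0) (gt_eqF s0) orbF /= => /eqP u0.
by move: kR; rewrite u0; lra.
Qed.

End curve.

Theorem corollary4p2 (R : realType) (beta : R) (hbeta : 0 < beta <= 1)
    (eta : R[i]) (heta : `|eta| = 1)
    (phi : unit_disc R -> unit_disc R)
    (hphi : forall z : unit_disc R, val (phi z) = eta * val z)
    (Cphi : {linear H2 beta -> H2 beta})
    (hbounded : bounded_operator Cphi)
    (hcomp : composition_operator phi Cphi) :
  convexC (berezin_range hbeta Cphi) <-> (eta = 1 \/ eta = -1).
Proof.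
rewrite (berezin_range_rotation hbeta hphi hcomp); split=> [cvx|[]->].
- have := convex_curve_Im hbeta heta cvx.
  case: eta heta {hphi cvx} => a b /= + b0; rewrite b0.
  rewrite normc_def /= expr0n /= addr0 sqrtr_sqr => -[/eqP].
  rewrite eqr_norml ler01 andbT => /orP[]/eqP->; [by left|right].
  by apply/eqP; rewrite eq_complex/= oppr0 !eqxx.
- exact: convex_curve1.
- exact: convex_curveN1.
Qed.
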